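(* Let $r \ge 3$ and $n \ge 1$ be integers, and let $\mathcal{H}$ be an $r$-uniform hypergraph on $n$ vertices that contains no Berge cycle of length $r+2$ or longer. Then $e(\mathcal{H}) \le \frac{r+1}{r}(n-1)$. Moreover, equality $e(\mathcal{H}) = \frac{r+1}{r}(n-1)$ holds if and only if the 2-shadow $\partial_2(\mathcal{H})$ is connected and for every block $D$ of $\partial_2(\mathcal{H})$, $D$ is a complete graph $K_{r+1}$ on $r+1$ vertices and $\mathcal{H}[D] = K_{r+1}^r$ (i.e. all $r+1$ of the $r$-element subsets of the vertex set of $D$ are hyperedges of $\mathcal{H}$).
   Context: Hypergraphs are finite, and the hyperedges form a set (no repeated hyperedges). $V(\mathcal{H})$ and $E(\mathcal{H})$ denote the vertex set and hyperedge set, and $e(\mathcal{H}) = |E(\mathcal{H})|$. A hypergraph is $r$-uniform if every hyperedge has exactly $r$ vertices. A Berge cycle of length $l$ in a hypergraph consists of $l$ distinct vertices $v_1, \ldots, v_l$ and $l$ distinct hyperedges $e_1, \ldots, e_l$ such that $\{v_i, v_{i+1}\} \subseteq e_i$ for all $1 \le i \le l$, with indices taken modulo $l$. The 2-shadow $\partial_2(\mathcal{H})$ is the graph on vertex set $V(\mathcal{H})$ whose edges are the pairs of vertices contained in some hyperedge of $\mathcal{H}$. For $S \subseteq V(\mathcal{H})$, $\mathcal{H}[S]$ is the subhypergraph induced by $S$: its vertex set is $S$ and its hyperedges are the hyperedges of $\mathcal{H}$ contained in $S$. For a block $D$ of $\partial_2(\mathcal{H})$, $\mathcal{H}[D]$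 means the subhypergraph induced by the vertex set of $D$. $K_{r+1}^r$ is the complete $r$-uniform hypergraph on $r+1$ vertices. Blocks are the usual blocks of a graph (maximal connected subgraphs with no cut vertex of their own), and are understood to have at least one edge; thus the one-vertex graph is connected and has no blocks. *)

(* Defs.v *)
From mathcomp Require Import all_boot.

Set Implicit Arguments.
Unset Strict Implicit.
Unset Printing Implicit Defensive.

(* The side condition is boolean, so two hypergraphs with the same vertex set
   and the same hyperedge set are Leibniz equal. *)
Record hypergraph (T : finType) := Hypergraph {
  vertices : {set T};
  hyperedges : {set {set T}};
  hyperedges_sub : cover hyperedges \subset vertices
}.

Definition uniform (T : finType) (r : nat) (H : hypergraph T) : Prop :=
  forall e, e \in hyperedges H -> #|e| = r.

(* Indices in 'I_l are 0-based, and ordS is the cyclic successor on 'I_l. *)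
Definition berge_cycle (T : finType) (H : hypergraph T) (l : nat)
    (v : 'I_l -> T) (e : 'I_l -> {set T}) : Prop :=
  [/\ injective v, injective e &
      forall i : 'I_l,
        e i \in hyperedges H /\ [set v i; v (ordS i)] \subset e i].

Lemma induced_subproof (T : finType) (H : hypergraph T) (S : {set T}) :
  cover [set e in hyperedges H | e \subset S] \subset S.
Proof. by apply/bigcupsP => e; rewrite inE => /andP[]. Qed.

(* Only meant for S \subset vertices H. *)
Definition induced (T : finType) (H : hypergraph T) (S : {set T}) :
    hypergraph T :=
  Hypergraph (induced_subproof H S).

Lemma complete_subproof (T : finType) (r : nat) (S : {set T}) :
  cover [set e : {set T} | (e \subset S) && (#|e| == r)] \subset S.
Proof. by apply/bigcupsP => e; rewrite inE => /andP[]. Qed.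

Definition complete (T : finType) (r : nat) (S : {set T}) : hypergraph T :=
  Hypergraph (complete_subproof r S).

Definition subhypergraph (T : finType) (G H : hypergraph T) : bool :=
  (vertices G \subset vertices H) && (hyperedges G \subset hyperedges H).

Lemma shadow2_subproof (T : finType) (H : hypergraph T) :
  cover [set p : {set T} |
          (#|p| == 2) && [exists e in hyperedges H, p \subset e]]
    \subset vertices H.
Proof.
apply/bigcupsP => p; rewrite inE => /andP[_ /exists_inP[e eH pe]].
apply: subset_trans pe (subset_trans _ (hyperedges_sub H)).
exact: bigcup_sup.
Qed.

(* A simple graph is represented as a 2-uniform hypergraph. *)
Definition shadow2 (T : finType) (H : hypergraph T) : hypergraph T :=
  Hypergraph (shadow2_subproof H).

(* The notions below are used only for simple graphs, i.e. when every member
   of hyperedges G is a pair. *)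

Definition adj (T : finType) (G : hypergraph T) : rel T :=
  fun x y => [set x; y] \in hyperedges G.

Definition connected_graph (T : finType) (G : hypergraph T) : Prop :=
  vertices G != set0 /\
  forall x y, x \in vertices G -> y \in vertices G -> connect (adj G) x y.

Definition delete_vertex (T : finType) (G : hypergraph T) (c : T) :
    hypergraph T :=
  induced G (vertices G :\ c).

(* c separates two other vertices of its component; equivalently, deleting c
   increases the number of connected components. *)
Definition cut_vertex (T : finType) (G : hypergraph T) (c : T) : Prop :=
  c \in vertices G /\
  exists x y,
    [/\ x \in vertices G :\ c, y \in vertices G :\ c, connect (adj G) x y &
        ~~ connect (adj (delete_vertex G c)) x y].

Definition connected_no_cut (T : finType) (G : hypergraph T) : Prop :=
  connected_graph G /\ forall c, ~ cut_vertex G c.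

(* Isolated vertices are not blocks: a block has at least one edge. *)
Definition block (T : finType) (G D : hypergraph T) : Prop :=
  [/\ subhypergraph D G, hyperedges D != set0, connected_no_cut D &
      forall D' : hypergraph T,
        subhypergraph D' G -> connected_no_cut D' -> subhypergraph D D' ->
        D' = D].

(* Main.v *)
(** Induction on the number of vertices.  If Hall's condition for choosing
    distinct hyperedges f v containing v fails on a set S, deleting S loses
    fewer than #|S| hyperedges and the bound is strict.  Otherwise take a
    longest path of the digraph with an arc from v to every vertex of f v, over
    all choices of f.  Pósa rotations at its end keep the path inside the vertex
    set and the hyperedges it already uses, so the end hyperedge and its
    rotations all lie in the last r + 1 vertices W, which therefore span at
    least r hyperedges.  Any two vertices of W are then joined by a Berge path
    through all of W, so a component K of the complement of W can be attached to
    W only by one hyperedge (the bound is again strict), or through one vertex x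
    (H is glued at x from two smaller hypergraphs, and so are its blocks).
    Conversely, a hypergraph with the block structure is grown from a vertex by
    adding blocks, each bringing (r + 1) / r hyperedges per new vertex. *)

Require Import Defs.
From HB Require Import structures.
From mathcomp Require Import all_boot all_order all_algebra zify.

Set Implicit Arguments.
Unset Strict Implicit.
Unset Printing Implicit Defensive.

(** * Hall's theorem *)

Section Hall.
Variables (A B : finType).

Definition nbrs (R : A -> B -> bool) (S : {set A}) : {set B} :=
  [set b | [exists a in S, R a b]].

Lemma nbrsP (R : A -> B -> bool) (S : {set A}) b :
  reflect (exists2 a, a \in S & R a b) (b \in nbrs R S).
Proof. by rewrite inE; apply: exists_inP. Qed.

Lemma hall (b0 : B) (R : A -> B -> bool) (X : {set A}) :
  (forall S : {set A}, S \subset X -> #|S| <= #|nbrs R S|) ->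
  exists f : A -> B,
    {in X, forall a, R a (f a)} /\ {in X &, injective f}.
Proof.
move: {2}#|X| (leqnn #|X|) => n; elim: n R X => [|n IHn] R X leXn hallX.
  have X0 : X = set0 by apply/eqP; rewrite -cards_eq0 -leqn0.
  by exists (fun=> b0); split=> [a|a b]; rewrite X0 inE.
have [/exists_inP[S]|/exists_inPn noS] :=
  boolP [exists S : {set A} in powerset X,
           [&& S != set0, S != X & #|nbrs R S| <= #|S|]].
  rewrite powersetE => sSX /and3P[S0 SX leS].
  have ltSX : #|S| < #|X| by rewrite proper_card // properEneq SX.
  have [||f1 [f1R f1I]] := IHn R S; first lia.
    by move=> S' sS'; apply: hallX; apply: subset_trans sSX.
  have S_gt0 : 0 < #|S| by rewrite card_gt0.
  have cD : #|X :\: S| + #|S| = #|X|.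
    by rewrite -(cardsID S X) (setIidPr sSX) addnC.
  have [||f2 [f2R f2I]] :=
      IHn (fun a b => R a b && (b \notin nbrs R S)) (X :\: S); first lia.
    move=> S' sS'; have sS'X := (subset_trans sS' (subsetDl _ _)).
    have dS : [disjoint S' & S].
      by apply: disjointWl sS' _; rewrite -setI_eq0 setIDAC setDIl setDv setI0.
    have := hallX (S' :|: S); rewrite subUset sS'X sSX => /(_ isT).
    rewrite cardsU (disjoint_setI0 dS) cards0 subn0 => le1.
    suff : nbrs R (S' :|: S) \subset
        nbrs (fun a b => R a b && (b \notin nbrs R S)) S' :|: nbrs R S.
      move/subset_leq_card; rewrite cardsU; lia.
    apply/subsetP=> b /nbrsP[a]; rewrite in_setU.
    case: (boolP (b \in nbrs R S)) => [|bN]; first by rewrite in_setU => ->; rewrite orbT.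
    case/orP=> [aS'|aS] Rab; rewrite in_setU; last by case/nbrsP: bN; exists a.
    by apply/orP; left; apply/nbrsP; exists a => //; rewrite Rab.
  exists (fun a => if a \in S then f1 a else f2 a); split=> [a aX|a b aX bX].
    case: ifPn => aS; first exact: f1R.
    by have /andP[] := f2R a ltac:(by rewrite !inE aS).
  have D a' b' : a' \in S -> b' \in X -> b' \notin S -> f1 a' <> f2 b'.
    move=> a'S b'X b'S e; have /andP[_ /nbrsP[]] := f2R b' ltac:(by rewrite !inE b'S).
    by exists a' => //; rewrite -e f1R.
  case: ifPn => aS; case: ifPn => bS e.
  - exact: f1I.
  - by case: (D a b).
  - by case: (D b a).
  - by apply: f2I; rewrite ?inE ?aS ?bS.
have [X0|[a aX]] := set_0Vmem X; first by exists (fun=> b0); split=> [a|a b]; rewrite X0 inE.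
have [b /nbrsP[_ /set1P-> Rab]] : exists b, b \in nbrs R [set a].
  apply/set0Pn; rewrite -card_gt0 (leq_trans _ (hallX _ _)) ?cards1 //.
  by rewrite sub1set.
have cX := cardsD1 a X; rewrite aX in cX.
have [||f [fR fI]] := IHn (fun a' b' => R a' b' && (b' != b)) (X :\ a); first lia.
  move=> S sS; have [->|S0] := eqVneq S set0; first by rewrite cards0.
  have sSX := subset_trans sS (subD1set X a).
  have SX : S != X.
    by apply: contraTneq aX => <-; apply/negP=> /(subsetP sS); rewrite !inE eqxx.
  have := noS S; rewrite powersetE sSX S0 SX -ltnNge => /(_ isT) lt.
  suff : nbrs R S \subset b |: nbrs (fun a' b' => R a' b' && (b' != b)) S.
    move/subset_leq_card; rewrite cardsU1; lia.
  apply/subsetP=> c /nbrsP[a' a'S Rc]; rewrite in_setU1; have [//|cb] := eqVneq c b.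
  by apply/nbrsP; exists a' => //; rewrite Rc.
have fN a' : a' \in X -> a' != a -> f a' != b.
  by move=> a'X a'a; have /andP[] := fR a' ltac:(by rewrite !inE a'a).
exists (fun a' => if a' == a then b else f a'); split=> [a' a'X|a1 a2 X1 X2].
  by case: eqP => [->//|/eqP a'a]; have /andP[] := fR a' ltac:(by rewrite !inE a'a).
case: eqP => [->|/eqP n1]; case: eqP => [->//|/eqP n2] e.
- by have := fN a2 X2 n2; rewrite -e eqxx.
- by have := fN a1 X1 n1; rewrite e eqxx.
- by apply: fI; rewrite ?inE ?n1 ?n2.
Qed.

End Hall.

(** * Berge cycles and dense sets of r + 1 vertices *)

Definition circumference_below (T : finType) (H : hypergraph T) (k : nat) : Prop :=
  forall (l : nat) (v : 'I_l -> T) (e : 'I_l -> {set T}),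
    k <= l -> ~ berge_cycle H v e.

Section BergeSeq.
Variable T : finType.
Implicit Types (H : hypergraph T) (c : seq (T * {set T})) (p q : T * {set T}).

(* A Berge walk v_0 e_0 v_1 e_1 ... is the sequence of the pairs (v_i, e_i). *)
Definition berge_step p q := (p.1 \in p.2) && (q.1 \in p.2).

Lemma berge_cycle_of_seq H c :
  cycle berge_step c -> uniq (unzip1 c) -> uniq (unzip2 c) ->
  {subset unzip2 c <= hyperedges H} ->
  exists (v : 'I_(size c) -> T) (e : 'I_(size c) -> {set T}), berge_cycle H v e.
Proof.
case: c => [|p0 c'] cyc uv ue sE.
  by exists (fun i : 'I_0 => False_rect _ (notF (ltn_ord i))),
            (fun i : 'I_0 => False_rect _ (notF (ltn_ord i))); split=> -[].
set c := p0 :: c' in cyc uv ue sE *.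
exists (fun i => (nth p0 c i).1), (fun i => (nth p0 c i).2); split.
- move=> i j /=; rewrite -!(nth_map _ p0.1 fst) // => /eqP.
  by rewrite nth_uniq ?size_map // => /eqP/val_inj.
- move=> i j /=; rewrite -!(nth_map _ p0.2 snd) // => /eqP.
  by rewrite nth_uniq ?size_map // => /eqP/val_inj.
move=> i; split; first by apply: sE; rewrite map_f ?mem_nth.
have : berge_step (nth p0 c i) (nth p0 c (i.+1 %% size c)).
  have := cyc; rewrite /= => /(pathP p0) /(_ i); rewrite size_rcons ltn_ord => /(_ isT).
  rewrite nth_rcons -rcons_cons nth_rcons (ltn_ord i).
  have [lt|ge] := ltnP i (size c').
    by rewrite modn_small //.
  have -> : i = size c' :> nat by have := ltn_ord i; rewrite /= in ge *; lia.
  by rewrite eqxx modnn.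
by case/andP=> h1 h2; rewrite subUset !sub1set h1.
Qed.

Lemma circumference_below_seq H k c :
  circumference_below H k ->
  cycle berge_step c -> uniq (unzip1 c) -> uniq (unzip2 c) ->
  {subset unzip2 c <= hyperedges H} -> size c < k.
Proof.
move=> Hk cyc uv ue sE; rewrite ltnNge; apply/negP=> le.
by have [v [e]] := berge_cycle_of_seq cyc uv ue sE; apply: Hk.
Qed.

End BergeSeq.

Section Dense.
Variables (T : finType) (H : hypergraph T) (r : nat).
Hypotheses (r2 : 2 <= r) (Hr : uniform r H) (Hc : circumference_below H (r + 2)).

Definition selects (f : T -> {set T}) : Prop :=
  {in vertices H, forall v, f v \in hyperedges H /\ v \in f v} /\
  {in vertices H &, injective f}.

(* The walk goes from the last vertex of s to the first one, each vertex lying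
   in the hyperedge selected by its predecessor. *)
Definition directed_path (f : T -> {set T}) (s : seq T) : bool :=
  [&& uniq s, s != [::], all [in vertices H] s & sorted (fun x y => x \in f y) s].

Lemma directed_cycle_bound f c :
  selects f -> uniq c -> all [in vertices H] c -> cycle (fun x y => x \in f y) c ->
  size c <= r.+1.
Proof.
move=> [fE fI] uc /allP cV cyc.
pose d := [seq (u, f (next c u)) | u <- c].
have nV u : u \in c -> next c u \in vertices H by move=> uc'; rewrite cV ?mem_next.
have d1 : unzip1 d = c by rewrite /unzip1 -map_comp /= map_id.
have d2 : unzip2 d = [seq f (next c u) | u <- c] by rewrite /unzip2 -map_comp.
have := @circumference_below_seq _ _ _ d Hc; rewrite size_map d1 d2 addn2 ltnS; apply=> //.
- rewrite cycle_map; apply: (@sub_in_cycle _ [in c] (fun x y => next c x == y)).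
  + move=> x y xc yc /eqP <-; rewrite /relpre /berge_step /=.
    by rewrite (next_cycle cyc xc) (fE _ (nV _ xc)).2.
  + exact/allP.
  + exact: cycle_next.
- rewrite map_inj_in_uniq // => x y xc yc /fI e.
  by apply: (can_inj (prev_next uc)); apply: e; apply: nV.
by move=> e /mapP[u uc' ->]; case: (fE _ (nV u uc')).
Qed.

Lemma selects_next f c :
  selects f -> uniq c -> all [in vertices H] c -> cycle (fun x y => x \in f y) c ->
  selects (f \o next c).
Proof.
move=> [fE fI] uc /allP cV cyc.
have nV u : u \in vertices H -> next c u \in vertices H.
  move=> uV; have [uc'|uc'] := boolP (u \in c); first by rewrite cV ?mem_next.
  by rewrite next_nth (negPf uc').
split=> [u uV|x y xV yV /= /fI e].
  split; first by case: (fE _ (nV u uV)).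
  have [uc'|uc'] := boolP (u \in c); first exact: (next_cycle cyc).
  by rewrite /= next_nth (negPf uc'); case: (fE u uV).
by apply: (can_inj (prev_next uc)); apply: e; apply: nV.
Qed.


Lemma perm_rotation p1 (x : T) p2 : perm_eq (rev (x :: p1) ++ p2) (p1 ++ x :: p2).
Proof.
rewrite -cat_rcons; apply: perm_cat => //.
by rewrite perm_rev perm_sym perm_rcons.
Qed.

(* Pósa rotation: the closed walk c of the path is traversed backwards, and f
   is shifted along c so that it still selects the hyperedges of the path. *)
Lemma directed_path_rotate f p1 x p2 (c := rcons p1 x) :
  selects f -> directed_path f (p1 ++ x :: p2) -> x \in f (head x p1) ->
  [/\ selects (f \o next c), directed_path (f \o next c) (rev (x :: p1) ++ p2),
      next c (last x p1) = x & size p1 <= r].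
Proof.
move=> sf /and4P[us _ Vs es] xf.
have [fE fI] := sf.
have uc : uniq c by move: us; rewrite -cat_rcons cat_uniq => /andP[].
have Vc : all [in vertices H] c by move: Vs; rewrite -cat_rcons all_cat => /andP[].
have cyc : cycle (fun x y => x \in f y) c.
  move: xf es; rewrite /c; case: (p1) => [|a p]; first by move=> /= ->.
  rewrite rcons_cons /= => xa; rewrite cat_path /= => /and3P[h1 h2 _].
  by rewrite rcons_path last_rcons xa rcons_path h1 h2.
have nxt : path (frel (next c)) x (rcons p1 x).
  have : cycle (frel (next c)) (rot 1 (x :: p1)) by rewrite rot1_cons cycle_next.
  by rewrite rot_cycle.
move: nxt; rewrite rcons_path => /andP[nxt /eqP nlast].
split=> //; first exact: selects_next.
  have ps := perm_rotation p1 x p2.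
  rewrite /directed_path (perm_uniq ps) us (perm_all _ ps) Vs /=.
  rewrite -size_eq0 (perm_size ps) size_cat addnS /=.
  rewrite lastI rev_rcons /= cat_path rev_path.
  have -> : last (last x p1) (rev (belast x p1)) = x.
    by case: (p1) => [|a p] //=; rewrite rev_cons last_rcons.
  apply/andP; split.
    apply: (@sub_in_path _ [in vertices H] (frel (next c))) nxt.
      move=> a b aV bV /= /eqP ab; rewrite ab; exact: (fE _ bV).2.
    by move: Vc; rewrite /c all_rcons.
  apply/(pathP x) => i lti /=.
  have xs : path (fun x y => x \in f y) x p2.
    by move: es; case: (p1) => [|a p] //=; rewrite cat_path /= => /and3P[].
  rewrite next_nth ifN; first exact: (pathP x xs).
  move: us; rewrite -cat_rcons cat_uniq => /and3P[_ /hasPn h _].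
  exact/h/mem_nth.
by have := directed_cycle_bound sf uc Vc cyc; rewrite size_rcons ltnS.
Qed.

Lemma hyperedge_sub e : e \in hyperedges H -> e \subset vertices H.
Proof. by move=> eE; apply: subset_trans (hyperedges_sub H); apply: bigcup_sup. Qed.

Lemma directed_path_head f x p1 p2 :
  directed_path f (p1 ++ x :: p2) -> selects f -> x \in f (head x p1) -> size p1 <= r.
Proof. by move=> ds sf xf; case: (directed_path_rotate sf ds xf). Qed.

(* On a longest path u_1, u_2, ... every f x with x in f u_1 starts a rotated
   longest path, so it has no vertex off the path; the cycle bound then keeps
   it within the first r + 1 vertices. *)
Lemma selects_dense f s :
  selects f -> directed_path f s ->
  exists W : {set T}, [/\ W \subset vertices H, #|W| = r.+1 &
    r <= #|[set e in hyperedges H | e \subset W]|].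
Proof.
have [n] := ubnP (#|T| - size s); elim: n f s => // n IHn f s ltn sf ds.
have [fE fI] := sf.
have /and4P[us] := ds; case: s => // u1 s' in ltn us ds *; move=> _ /allP Vs _.
set s := u1 :: s' in ltn us ds Vs *.
have uV : u1 \in vertices H by rewrite Vs ?mem_head.
have sizeT (q : seq T) : uniq q -> size q <= #|T|.
  by move=> uq; rewrite -(card_uniqP uq) max_card.
have split_at (q : seq T) z : z \in q -> exists p1 p2, q = p1 ++ z :: p2.
  by case/splitPr=> p1 p2; exists p1, p2.
have head_split p1 x p2 : s = p1 ++ x :: p2 -> head x p1 = u1.
  by case: p1 => [|a p] [].
have [/existsP[x /and3P[xu xs /subsetPn[y yx ys]]]|/existsPn noext] :=
    boolP [exists x, [&& x \in f u1, x \in s & ~~ (f x \subset s)]].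
  have [p1 [p2 def_s]] := split_at _ _ xs.
  have xh : x \in f (head x p1) by rewrite (head_split _ _ _ def_s).
  rewrite def_s in ds; have [sf' ds' nl _] := directed_path_rotate sf ds xh.
  have ps : perm_eq (rev (x :: p1) ++ p2) s by rewrite def_s perm_rotation.
  have ds2 : directed_path (f \o next (rcons p1 x)) (y :: rev (x :: p1) ++ p2).
    have /and4P[us' _ Vs' es'] := ds'.
    have yV : y \in vertices H.
      by have := fE x (Vs x _) => -[]; rewrite ?def_s ?mem_cat ?mem_head ?orbT //
        => /hyperedge_sub/subsetP->.
    rewrite /directed_path /= us' (perm_mem ps) ys yV Vs' /=.
    by move: es'; rewrite lastI rev_rcons /= nl yx.
  have /and4P[/sizeT leT _ _ _] := ds2.
  apply: IHn sf' ds2; move: leT ltn; rewrite -(perm_size ps).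
  by rewrite [size (y :: _)]/=; move: (size _) #|T|; clear; lia.
have us_sub : f u1 \subset s.
  apply: contraR (noext u1) => ->.
  by rewrite (fE u1 uV).2 mem_head.
pose W := [set z in take r.+1 s].
have fW x : x \in f u1 -> f x \subset W.
  move=> xu; have xs : x \in s by apply: (subsetP us_sub).
  have fxs : f x \subset s by have := noext x; rewrite xu xs negbK.
  apply/subsetP=> y yx; have {fxs} : y \in s by apply: (subsetP fxs).
  move=> ys; have [p1 [p2 def_s]] := split_at _ _ xs.
  have xh : x \in f (head x p1) by rewrite (head_split _ _ _ def_s).
  rewrite def_s in ds; have [sf' ds' nl lep1] := directed_path_rotate sf ds xh.
  set s1 := rev (x :: p1) ++ p2 in ds'.
  have ps : perm_eq s1 s by rewrite def_s perm_rotation.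
  have ys1 : y \in s1 by rewrite (perm_mem ps).
  have yt : y \in take r.+1 s1.
    have [q1 [q2 def_s1]] := split_at _ _ ys1.
    have yh : y \in (f \o next (rcons p1 x)) (head y q1).
      suff -> : head y q1 = last x p1 by rewrite /= nl.
      move: def_s1; rewrite /s1 lastI rev_rcons /=.
      by case: (q1) => [|a q] [].
    rewrite def_s1 in ds'; have := directed_path_head ds' sf' yh => leq1.
    rewrite def_s1 -cat_rcons take_cat size_rcons ltnS ltnNge leq1 /=.
    by rewrite mem_cat mem_rcons mem_head.
  move: yt; rewrite inE def_s -cat_rcons /s1 !take_cat size_rev size_rcons /= ltnS.
  by rewrite ltnNge lep1 /= !mem_cat mem_rev mem_rcons.
have cf x : x \in vertices H -> #|f x| = r by move=> xV; apply/Hr/(fE x xV).1.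
have fuV : f u1 \subset vertices H by apply/hyperedge_sub/(fE _ uV).1.
have leD : r <= #|[set e in hyperedges H | e \subset W]|.
  rewrite -{1}(cf u1 uV) -(card_in_imset (f := f) (D := f u1)).
    apply/subset_leq_card/subsetP=> e /imsetP[x xu ->]; rewrite inE fW // andbT.
    exact/(fE x (subsetP fuV x xu)).1.
  by move=> x y xu yu; apply: fI; apply: (subsetP fuV).
exists W; split=> //.
  by apply/subsetP=> z; rewrite inE => /mem_take/Vs.
have leW : #|W| <= r.+1.
  by rewrite cardsE (leq_trans (card_size _)) // size_take_min geq_minl.
apply/eqP; rewrite eqn_leq leW ltnNge; apply/negP=> leWr.
suff : #|[set e in hyperedges H | e \subset W]| <= 1 by lia.
apply/card_le1_eqP=> e1 e2; rewrite !inE => /andP[/Hr c1 s1] /andP[/Hr c2 s2].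
have E (e : {set T}) : #|e| = r -> e \subset W -> e = W.
  by move=> ce se; apply/eqP; rewrite eqEcard se ce.
by rewrite (E e1 c1 s1) (E e2 c2 s2).
Qed.
End Dense.

(** * Attachments to a dense set *)

Section Attachments.
Variables (T : finType) (H : hypergraph T) (r : nat) (W : {set T}).
Hypotheses (r3 : 3 <= r) (cW : #|W| = r.+1).
(* With W ordered as z_0 = y, z_1 = b, ..., z_r = x, the pair z_i z_(i+1) uses
   the hyperedge W \ z_(i+2) for i < r - 1, and the last pair uses W \ a, where
   a is y or b.  The order and a are chosen so that W \ M is not used. *)
Lemma dense_spanning_path M x y :
  M \in W -> {in W, forall w, w != M -> W :\ w \in hyperedges H} ->
  x \in W -> y \in W -> x != y -> x != M ->
  exists e0 c, [/\ forall f, path (@berge_step T) (y, e0) (rcons c (x, f)),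
    size c = r.-1, uniq (rcons (unzip1 ((y, e0) :: c)) x),
    uniq (unzip2 ((y, e0) :: c)) &
    {subset unzip1 ((y, e0) :: c) <= W} /\
    {in unzip2 ((y, e0) :: c), forall e, e \in hyperedges H /\ e \subset W}].
Proof.
move=> MW ME xW yW xy xM.
have [a [b [bW bx byy aM [ayb Myb]]]] : exists a b,
    [/\ b \in W, b != x, b != y, a != M & a \in [:: y; b] /\ M \in [:: y; b]].
  have [yM|yM] := eqVneq y M; last first.
    by exists y, M; rewrite MW eq_sym xM eq_sym yM !inE !eqxx orbT.
  have /card_gt0P[b] : 0 < #|W :\ x :\ y|.
    have yWx : y \in W :\ x by rewrite !inE eq_sym xy.
    have := cardsD1 x W; have := cardsD1 y (W :\ x).
    by rewrite yWx xW cW; case: (r) r3 => [|k]; lia.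
  rewrite !inE => /and3P[byy bx bW]; exists b, b.
  by rewrite -yM !inE !eqxx orbT.
pose t := enum (W :\ x :\ y :\ b).
have mt w : (w \in t) = [&& w != b, w != y, w != x & w \in W].
  by rewrite mem_enum !inE.
pose zs := y :: b :: rcons t x.
have uzs : uniq zs.
  rewrite /= inE !mem_rcons !inE !mt !eqxx rcons_uniq mt eqxx !andbF /= enum_uniq.
  by rewrite orbF (negPf bx) eq_sym (negPf byy) eq_sym (negPf xy).
have mzs : zs =i W.
  move=> w; rewrite !inE mem_rcons inE mt.
  case: (eqVneq w y) => [->//|_]; case: (eqVneq w b) => [->//|_] /=.
  by case: (eqVneq w x) => [->//|_].
have szs : size zs = r.+1 by rewrite -cW -(card_uniqP uzs) (eq_card mzs).
pose ds := rcons (rcons t x) a.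
have aN : a \notin rcons t x.
  rewrite mem_rcons inE mt; move: ayb; rewrite !inE => /orP[]/eqP ->.
    by rewrite eqxx andbF orbF eq_sym.
  by rewrite eqxx orbF.
have uds : uniq ds.
  by rewrite rcons_uniq aN; case/and3P: uzs.
have st : size (rcons t x) = r.-1 by move: szs => /= [<-].
have sds : size ds = r by move: szs; rewrite /= !size_rcons => -[].
have dsE : {in ds, forall w, W :\ w \in hyperedges H}.
  move=> w; rewrite mem_rcons inE => wds; apply: ME.
    case/orP: wds => [/eqP ->|wt]; last by rewrite -mzs !inE wt !orbT.
    by rewrite -mzs; move: ayb; rewrite !inE => /orP[] ->; rewrite ?orbT.
  case/orP: wds => [/eqP -> //|]; rewrite mem_rcons inE => /orP[/eqP -> //|].
  rewrite mt => /and4P[wb wy _ _]; move: Myb; rewrite !inE.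
  by case/orP=> /eqP ->.
pose F i := (nth x zs i, W :\ nth x ds i).
have Fds i : i < r -> nth x zs i != nth x ds i /\ nth x zs i.+1 != nth x ds i.
  move=> ir; have [lt|ge] := ltnP i r.-1.
    have -> : nth x ds i = nth x zs i.+2.
      by rewrite /ds nth_rcons st lt.
    by rewrite !nth_uniq ?szs //; clear -r3 lt; lia.
  have -> : i = r.-1 by clear -ir ge; lia.
  have -> : nth x ds r.-1 = a.
    by rewrite /ds nth_rcons st ltnn eqxx.
  have [j j2 ->] : exists2 j, j < 2 & a = nth x zs j.
    by move: ayb; rewrite !inE => /orP[]/eqP ->; [exists 0|exists 1].
  by rewrite !nth_uniq ?szs //; clear -r3 j2; lia.
exists (F 0).2, (mkseq (F \o S) r.-1).
have def_c : (y, (F 0).2) :: mkseq (F \o S) r.-1 = mkseq F r.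
  by rewrite /mkseq -{2}(ltn_predK r3) /= -[1]/(1 + 0) iotaDl -map_comp.
have sz_take : size (take r zs) = r by rewrite size_takel ?szs.
have u1E : unzip1 (mkseq F r) = take r zs.
  rewrite /mkseq /unzip1 -map_comp; apply: (@eq_from_nth _ x).
    by rewrite size_map size_iota sz_take.
  move=> i; rewrite size_map size_iota => ir.
  by rewrite (nth_map 0) ?size_iota // nth_iota // nth_take.
have u2E : unzip2 (mkseq F r) = [seq W :\ w | w <- ds].
  rewrite /mkseq /unzip2 -map_comp; apply: (@eq_from_nth _ W).
    by rewrite !size_map size_iota sds.
  move=> i; rewrite size_map size_iota => ir.
  by rewrite (nth_map 0) ?size_iota // nth_iota // (nth_map x) ?sds.
have zsE : rcons (take r zs) x = zs.
  have st' : size (y :: b :: t) = r by rewrite -sds !size_rcons.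
  have -> : zs = (y :: b :: t) ++ [:: x] by rewrite /zs -cats1.
  by rewrite take_size_cat // cats1.
have dsW w : w \in ds -> w \in W.
  rewrite mem_rcons inE => /orP[/eqP->|wt]; last by rewrite -mzs !inE wt !orbT.
  by rewrite -mzs; move: ayb; rewrite !inE => /orP[] ->; rewrite ?orbT.
split=> [f||||].
- have : path (@berge_step T) (y, (F 0).2) (rcons (mkseq (F \o S) r.-1) (x, f)).
    apply/(pathP (x, f)) => i; rewrite size_rcons size_mkseq (ltn_predK r3) => ir.
    have -> : nth (x, f) (rcons (mkseq (F \o S) r.-1) (x, f)) i =
        nth (x, f) (rcons (mkseq F r) (x, f)) i.+1 by rewrite -def_c.
    rewrite -rcons_cons def_c !nth_rcons size_mkseq ir nth_mkseq // /berge_step /=.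
    have [neq neqS] := Fds i ir.
    have zsW j : j <= r -> nth x zs j \in W by move=> jr; rewrite -mzs mem_nth ?szs.
    rewrite !inE neq zsW ?(ltnW ir) //=.
    have -> : (if i.+1 < r then nth (x, f) (mkseq F r) i.+1
        else if i.+1 == r then (x, f) else (x, f)).1 = nth x zs i.+1.
      case: ifP => [iS|/negbT iS]; first by rewrite nth_mkseq.
      have -> : i.+1 = r by apply/eqP; rewrite eqn_leq ir leqNgt.
      by rewrite eqxx /= -zsE nth_rcons sz_take ltnn eqxx.
    by rewrite neqS zsW.
  by [].
- by rewrite size_mkseq.
- by rewrite def_c u1E zsE.
- rewrite def_c u2E map_inj_in_uniq // => u v ud vd uv.
  apply: contraTeq (dsW u ud) => neq.
  by have := setD11 u W; rewrite uv !inE neq /= => ->.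
split; first by rewrite def_c u1E => u /mem_take; rewrite mzs.
rewrite def_c u2E => e /mapP[w wd ->]; split; first exact: dsE.
exact: subsetDl.
Qed.
Hypotheses (Hr : uniform r H)
  (dense : r <= #|[set e in hyperedges H | e \subset W]|).

Lemma dense_missing :
  exists2 M, M \in W & {in W, forall w, w != M -> W :\ w \in hyperedges H}.
Proof.
pose N := [set w in W | W :\ w \notin hyperedges H].
have leN : #|N| <= 1.
  suff : #|[set e in hyperedges H | e \subset W]| <= #|W :\: N|.
    have sN : N \subset W by apply/subsetP=> w; rewrite inE => /andP[].
    by have := cardsID N W; rewrite (setIidPr sN); lia.
  apply: leq_trans (leq_imset_card (fun w => W :\ w) _).
  apply/subset_leq_card/subsetP=> e; rewrite inE => /andP[eE sW].
  have : #|W :\: e| == 1.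
    by have := cardsID e W; rewrite (setIidPr sW) (Hr eE); lia.
  case/cards1P=> w We.
  have def_e : e = W :\ w by rewrite -We setDDr setDv set0U (setIidPr sW).
  apply/imsetP; exists w => //; rewrite !inE -def_e eE andbF /=.
  by have := set11 w; rewrite -We inE => /andP[].
have [N0|[M MN]] := set_0Vmem N.
  have /card_gt0P[M MW] : 0 < #|W| by rewrite cW.
  exists M => // w wW _; have : w \notin N by rewrite N0 inE.
  by rewrite inE wW negbK.
exists M => [|w wW wM]; first by move: MN; rewrite inE => /andP[].
apply: contraR wM => wE.
by rewrite (card_le1_eqP leN w M) // inE wW.
Qed.

End Attachments.

Section Outside.
Variables (T : finType) (H : hypergraph T) (W : {set T}).

Definition incidence_off (p q : T + {set T}) : bool :=
  match p, q with
  | inl v, inr e | inr e, inl v => [&& e \in hyperedges H, v \in e & v \notin W]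
  | _, _ => false
  end.

Lemma incidence_off_sym : symmetric incidence_off.
Proof. by case=> [v|e] [w|g]. Qed.

Definition interleave (k : seq (T * {set T})) : seq (T + {set T}) :=
  flatten [seq [:: inl q.1; inr q.2] | q <- k].

Lemma interleave_of_path (f g : {set T}) p :
  path incidence_off (inr f) p -> last (inr f) p = inr g ->
  exists k, p = interleave k.
Proof.
have [n] := ubnP (size p); elim: n f p => // n IHn f [|[v|e] [|[w|h] p]] //=.
- by exists [::].
- by rewrite andbF.
move=> ltn /and3P[_ _ pp] lp; have [|k ->] := IHn h p _ pp lp.
  by rewrite ltnS in ltn; apply: ltnW.
by exists ((v, h) :: k).
Qed.

Lemma mem_interleave1 v k : (inl v \in interleave k) = (v \in unzip1 k).
Proof. by elim: k => //= q k IH; rewrite !inE IH. Qed.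

Lemma mem_interleave2 (e : {set T}) k : (inr e \in interleave k) = (e \in unzip2 k).
Proof. by elim: k => //= q k IH; rewrite !inE IH. Qed.

Lemma uniq_interleave k : uniq (interleave k) -> uniq (unzip1 k) && uniq (unzip2 k).
Proof.
elim: k => //= q k IH; rewrite inE /= mem_interleave1 mem_interleave2.
by case/and3P=> -> -> /IH.
Qed.

Lemma interleave_step (f : {set T}) x k :
  x \in f -> path incidence_off (inr f) (interleave k) ->
  path (@berge_step T) (x, f) k /\
  {in k, forall q : T * {set T}, [/\ q.1 \in q.2, q.1 \notin W & q.2 \in hyperedges H]}.
Proof.
elim: k f x => //= -[v h] k IH f x xf /= /and3P[/and3P[_ vf _] /and3P[hE vh vW]].
case/(IH _ v vh) => pk kP; split; first by rewrite /berge_step /= xf vf.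
by move=> q; rewrite inE => /orP[/eqP ->|/kP].
Qed.

Lemma outside_berge_path (f g : {set T}) x :
  connect incidence_off (inr f) (inr g) -> x \in f ->
  exists k, [/\ path (@berge_step T) (x, f) k, uniq (unzip1 k),
    uniq (f :: unzip2 k), last f (unzip2 k) = g &
    {in k, forall q : T * {set T}, [/\ q.1 \in q.2, q.1 \notin W & q.2 \in hyperedges H]}].
Proof.
case/connectP=> p /shortenP[{}p pp up _] lp xf.
have [k def_p] := interleave_of_path pp (esym lp); rewrite def_p in pp up lp.
exists k; have [pk kP] := interleave_step xf pp; split=> //.
- by case/andP: up => _ /uniq_interleave/andP[].
- case/andP: up => fk /uniq_interleave/andP[_ /= ->].
  by rewrite -mem_interleave2 fk.
have lI : last (inr f) (interleave k) = inr (last f (unzip2 k)) :> T + {set T}.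
  by elim: (k) (f) => //= q k' IH f'; rewrite IH.
by move: lp; rewrite lI => -[].
Qed.

End Outside.

Section TwoAttachments.
Variables (T : finType) (H : hypergraph T) (r : nat) (W : {set T}).
Hypotheses (r3 : 3 <= r) (Hr : uniform r H) (cW : #|W| = r.+1).
Hypothesis dense : r <= #|[set e in hyperedges H | e \subset W]|.
Hypothesis Hc : circumference_below H (r + 2).

Lemma attachment_unique (f g : {set T}) x y :
  f \in hyperedges H -> g \in hyperedges H ->
  connect (incidence_off H W) (inr f) (inr g) -> f != g ->
  x \in f :&: W -> y \in g :&: W -> x = y.
Proof.
move=> fE gE fg fNg xfW yfW; apply/eqP/negPn/negP=> xy.
have [M MW ME] := dense_missing r3 cW Hr dense.
wlog xM : f g x y fE gE fg fNg xfW yfW xy / x != M.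
  move=> wl; have [xM|] := eqVneq x M; last exact: wl xfW yfW xy.
  have gf : connect (incidence_off H W) (inr g) (inr f).
    by rewrite (sym_connect_sym (@incidence_off_sym _ H W)).
  by apply: (wl g f y x); rewrite // 1?eq_sym // -xM.
have /setIP[xf xW] := xfW; have /setIP[yg yW] := yfW.
have [e0 [c [pc sc uc1 uc2 [cW1 cW2]]]] := dense_spanning_path r3 cW MW ME xW yW xy xM.
have [k [pk uk1 uk2 lk kP]] := outside_berge_path fg xf.
have k0 : k != [::] by apply: contraNneq fNg => k0; rewrite -lk k0.
have kW v : v \in unzip1 k -> v \notin W by case/mapP=> q /kP[_ + _] ->.
pose d := ((y, e0) :: c) ++ (x, f) :: k.
have kE e : e \in f :: unzip2 k -> e \in hyperedges H /\ ~~ (e \subset W).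
  have sub v (e' : {set T}) : v \in e' -> v \notin W -> ~~ (e' \subset W).
    by move=> ve'; apply: contra => /subsetP/(_ v ve').
  rewrite inE => /orP[/eqP->|/mapP[q /kP[q12 qW qE] ->]].
    split=> //; case: (k) k0 pk kP => //= q k' _ /andP[/andP[_ qf] _] kP.
    by case: (kP q (mem_head _ _)) => _ qW _; apply: sub qf qW.
  by split=> //; apply: sub q12 qW.
have : size d < r + 2.
  apply: (circumference_below_seq Hc).
  - rewrite /d /= rcons_cat cat_path /=; have := pc f.
    rewrite rcons_path => /andP[-> ->] /=; rewrite rcons_path pk /=.
    move: lk kP; case/lastP: (k) k0 => // k' q _.
    rewrite /unzip2 map_rcons !last_rcons => qg /(_ q).
    by rewrite mem_rcons mem_head => /(_ isT)[q12 _ _]; rewrite /berge_step /= q12 qg.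
  - have -> : unzip1 d = rcons (unzip1 ((y, e0) :: c)) x ++ unzip1 k.
      by rewrite cat_rcons /unzip1 map_cat.
    rewrite cat_uniq uc1 uk1 andbT.
    apply/hasPn=> v /kW; apply: contra; rewrite mem_rcons inE => /orP[/eqP->//|].
    exact: cW1.
  - have -> : unzip2 d = unzip2 ((y, e0) :: c) ++ f :: unzip2 k.
      by rewrite /unzip2 map_cat.
    rewrite cat_uniq uc2 uk2 andbT.
    by apply/hasPn=> e /kE[_]; apply: contra => /cW2[].
  move=> e; rewrite /unzip2 map_cat mem_cat => /orP[/cW2[]//|].
  by case/kE.
rewrite size_cat /= sc; case: (k) k0 r3 => //= _ k' _; clear; lia.
Qed.

End TwoAttachments.

(** * Block structure *)

Section Tight.
Variables (T : finType) (r : nat).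
Implicit Types (G H D : hypergraph T) (S K W : {set T}).

Definition tight H : Prop :=
  connected_graph (shadow2 H) /\
  forall D, block (shadow2 H) D ->
    [/\ #|vertices D| = (r + 1)%N, D = complete 2 (vertices D) &
        induced H (vertices D) = complete r (vertices D)].

Lemma hypergraph_eq G H :
  vertices G = vertices H -> hyperedges G = hyperedges H -> G = H.
Proof.
case: G H => [V E s] [V' E' s'] /= eV eE; subst; congr Hypergraph.
exact: bool_irrelevance.
Qed.

Lemma subhypergraph_trans G H D :
  subhypergraph G H -> subhypergraph H D -> subhypergraph G D.
Proof.
case/andP=> a b /andP[c d]; apply/andP.
by split; [apply: subset_trans c|apply: subset_trans d].
Qed.

Lemma adj_sym G : symmetric (adj G).
Proof. by move=> x y; rewrite /adj setUC. Qed.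

Lemma adj_vertices G x y : adj G x y -> (x \in vertices G) /\ (y \in vertices G).
Proof.
move/hyperedge_sub; rewrite subUset !sub1set => /andP[]; by split.
Qed.

Lemma shadow2_edgeP H (p : {set T}) :
  reflect (#|p| = 2 /\ exists2 e, e \in hyperedges H & p \subset e)
          (p \in hyperedges (shadow2 H)).
Proof.
rewrite inE; apply: (iffP andP) => [[/eqP c /exists_inP h]|[c h]]; split=> //.
  by rewrite c.
exact/exists_inP.
Qed.

Lemma adj_shadow2P H x y :
  reflect (x != y /\ exists2 e, e \in hyperedges H & (x \in e) && (y \in e))
          (adj (shadow2 H) x y).
Proof.
apply: (iffP (shadow2_edgeP _ _)) => -[c [e eE se]].
  split; first by move: c; rewrite cards2; case: (x != y).
  by exists e => //; rewrite -!sub1set -subUset.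
by split; [rewrite cards2 c|exists e; rewrite // subUset !sub1set].
Qed.

Lemma connect_invariant G (P : pred T) x y :
  connect (adj G) x y -> P x ->
  (forall a b, P a -> adj G a b -> P b) -> P y.
Proof.
move=> /connectP[p pp ->] Px cl; elim: p x Px pp => //= b p IH x Px /andP[ab].
exact: IH (cl _ _ Px ab).
Qed.

Lemma induced_shadow2_sub H S :
  S \subset vertices H -> subhypergraph (shadow2 (induced H S)) (shadow2 H).
Proof.
move=> sS; rewrite /subhypergraph sS; apply/subsetP=> p /shadow2_edgeP[c [e]].
by rewrite inE => /andP[eE _] pe; apply/shadow2_edgeP; split=> //; exists e.
Qed.

Lemma induced_induced H S S' : S' \subset S -> induced (induced H S) S' = induced H S'.
Proof.
move=> sS; apply: hypergraph_eq => //=; apply/setP=> e; rewrite !inE.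
by case: (boolP (e \subset S')) => [/subset_trans->|]; rewrite ?andbF ?andbT.
Qed.

Lemma block_restrict H S D :
  S \subset vertices H -> block (shadow2 H) D ->
  subhypergraph D (shadow2 (induced H S)) -> block (shadow2 (induced H S)) D.
Proof.
move=> sS [_ D0 Dc Dmax] sD; split=> // D' sD'; apply: Dmax.
exact: subhypergraph_trans sD' (induced_shadow2_sub sS).
Qed.

Lemma tight_glue H K x :
  K \subset vertices H -> x \in vertices H -> x \notin K ->
  {in hyperedges H, forall e : {set T}, (e \subset x |: K) || (e \subset vertices H :\: K)} ->
  tight (induced H (x |: K)) -> tight (induced H (vertices H :\: K)) -> tight H.
Proof.
move=> sK xV xK split_e [[_ c1] b1] [[_ c2] b2].
have sV1 : x |: K \subset vertices H by rewrite subUset sub1set xV.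
have sV2 : vertices H :\: K \subset vertices H by apply: subsetDl.
have lift S y z : S \subset vertices H ->
    connect (adj (shadow2 (induced H S))) y z -> connect (adj (shadow2 H)) y z.
  move=> sS; apply: connect_sub => a b ab; apply: connect1.
  by have /andP[_ /subsetP] := induced_shadow2_sub sS; apply.
have toX y : y \in vertices H -> connect (adj (shadow2 H)) y x.
  move=> yV; have [yK|yK] := boolP (y \in K).
    by apply: lift sV1 (c1 _ _ _ _); rewrite !inE ?eqxx ?yK ?orbT.
  by apply: lift sV2 (c2 _ _ _ _); rewrite !inE ?yK ?xK ?xV.
split; first split.
- by apply/set0Pn; exists x.
- move=> y z /toX yx /toX; rewrite (sym_connect_sym (@adj_sym (shadow2 H))).
  exact: connect_trans yx.
move=> D bD; have [sD D0 [[_ Dc] Dcut] Dmax] := bD.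
have /andP[/subsetP sDV /subsetP sDE] := sD.
have sDsub S : S = x |: K \/ S = vertices H :\: K -> vertices D \subset S ->
    subhypergraph D (shadow2 (induced H S)).
  move=> eS sDS; rewrite /subhypergraph sDS; apply/subsetP=> p pD.
  have /shadow2_edgeP[c [e eE pe]] := sDE p pD.
  have pS := subset_trans (hyperedge_sub pD) sDS.
  apply/shadow2_edgeP; split=> //; exists e => //; rewrite inE eE /=.
  have small S' : e \subset S' -> S' :&: S \subset [set x] -> False.
    move=> sS' sx; have : p \subset [set x].
      by apply: subset_trans sx; rewrite subsetI pS (subset_trans pe).
    by move/subset_leq_card; rewrite c cards1.
  have := split_e e eE; case: eS => eS; rewrite {}eS in sDS pS small *.
    case/orP=> // /small[]; apply/subsetP=> v; rewrite !inE.
    by case: (v == x); case: (v \in K); rewrite ?andbF.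
  rewrite orbC; case/orP=> // /small[]; apply/subsetP=> v; rewrite !inE.
  by case: (v == x); case: (v \in K); rewrite ?andbF.
(* Otherwise x would be a cut vertex of D. *)
have : (vertices D \subset x |: K) || (vertices D \subset vertices H :\: K).
  apply/negPn/negP; rewrite negb_or => /andP[/subsetPn[b bD' bK] /subsetPn[a aD aK]].
  have {}aK : a \in K by move: aK; rewrite inE (sDV _ aD) andbT negbK.
  move: bK; rewrite !inE negb_or => /andP[bx bK].
  have ax : a != x by apply: contraNneq xK => <-.
  have cross p q : p \in K -> adj D p q -> q != x -> q \in K.
    move=> pK /sDE/adj_shadow2P[_ [e eE /andP[pe qe]]] qx.
    have /orP[se|se] := split_e e eE.
      by have := subsetP se q qe; rewrite !inE (negPf qx).
    by have := subsetP se p pe; rewrite !inE pK.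
  have cab := Dc a b aD bD'.
  have [xD|xD] := boolP (x \in vertices D).
    apply: (Dcut x); split=> //; exists a, b; split; rewrite ?inE ?ax ?bx //.
    apply/negP=> cab'; move/negP: bK; apply.
    apply: (connect_invariant (P := [in K]) cab' aK) => p q pK pq.
    have pq' : adj D p q by move: pq; rewrite /adj inE => /andP[].
    apply: (cross _ _ pK pq'); have [_] := adj_vertices pq.
    by rewrite !inE => /andP[].
  move/negP: bK; apply; apply: (connect_invariant (P := [in K]) cab aK) => p q pK pq.
  by apply: (cross _ _ pK pq); apply: contraNneq xD => <-; case: (adj_vertices pq).
case/orP=> sDS.
  have [] := b1 D (block_restrict sV1 bD (sDsub _ (or_introl erefl) sDS)).
  by rewrite induced_induced.
have [] := b2 D (block_restrict sV2 bD (sDsub _ (or_intror erefl) sDS)).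
by rewrite induced_induced.
Qed.

Lemma complete2_adj W x y : x \in W -> y \in W -> x != y -> adj (complete 2 W) x y.
Proof. by move=> xW yW xy; rewrite /adj inE subUset !sub1set xW yW cards2 xy. Qed.

Lemma complete2_no_cut W : W != set0 -> connected_no_cut (complete 2 W).
Proof.
move=> W0; split=> [|c [_ [x [y [xW yW _]]]]]; first split=> // x y xW yW.
  by have [->|xy] := eqVneq x y; rewrite ?connect0 // connect1 // complete2_adj.
have [->|xy] := eqVneq x y; rewrite ?connect0 // connect1 //.
rewrite /adj inE; apply/andP; split; last by rewrite subUset !sub1set xW.
by apply: complete2_adj xy; [case/setD1P: xW|case/setD1P: yW].
Qed.

Lemma tight1 H : 1 < r -> uniform r H -> #|vertices H| = 1 -> tight H.
Proof.
move=> r1 Hr /eqP/cards1P[x Vx]; split.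
  split=> [|y z]; rewrite /= Vx; first by apply/set0Pn; exists x; rewrite set11.
  by move=> /set1P-> /set1P->; rewrite connect0.
move=> D [/andP[sV sE] /set0Pn[p pD] _ _].
have /shadow2_edgeP[c _] := subsetP sE p pD.
have := subset_leq_card (subset_trans (hyperedge_sub pD) sV).
by rewrite /= Vx c cards1.
Qed.

Lemma tight_complete H :
  2 < r -> #|vertices H| = r.+1 -> H = complete r (vertices H) -> tight H.
Proof.
move=> r2 cV HE; set W := vertices H in cV HE *.
have W0 : W != set0 by rewrite -card_gt0 cV.
have sh : shadow2 H = complete 2 W.
  apply: hypergraph_eq => //; apply/setP=> p; rewrite [RHS]inE.
  apply/shadow2_edgeP/andP=> [[c [e eE pe]]|[pW /eqP c]].
    by rewrite c (subset_trans pe (hyperedge_sub eE)).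
  split=> //.
  have [w] : exists w, w \in W :\: p.
    apply/set0Pn; rewrite -card_gt0; have := cardsID p W.
    by rewrite (setIidPr pW) c cV; lia.
  rewrite inE => /andP[wp wW]; exists (W :\ w).
    rewrite HE inE subsetDl /=; have := cardsD1 w W; rewrite wW cV add1n => -[<-].
    exact: eqxx.
  by rewrite subsetD1 pW.
rewrite /tight sh; split; first by case: (complete2_no_cut W0).
move=> D [sD _ _ Dmax].
have <- : complete 2 W = D.
  by apply: Dmax sD; [rewrite /subhypergraph !subxx|apply: complete2_no_cut].
split; rewrite /= ?addn1 //; rewrite -HE; apply: hypergraph_eq => //=.
apply/setP=> e; rewrite inE; case: (boolP (e \in _)) => //= eE.
exact: hyperedge_sub eE.
Qed.

End Tight.

Section Converse.
Variables (T : finType).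
Implicit Types (G H D : hypergraph T) (U W : {set T}).

Lemma subhypergraph_size G H :
  subhypergraph G H -> G <> H ->
  #|vertices G| + #|hyperedges G| < #|vertices H| + #|hyperedges H|.
Proof.
case/andP=> sV sE neq; have leV := subset_leq_card sV; have leE := subset_leq_card sE.
rewrite ltnNge; apply/negP=> le; apply: neq; apply: hypergraph_eq.
  by apply/eqP; rewrite eqEcard sV; lia.
by apply/eqP; rewrite eqEcard sE; lia.
Qed.

Lemma block_containing G D :
  subhypergraph D G -> hyperedges D != set0 -> connected_no_cut D ->
  classically (exists2 B, block G B & subhypergraph D B).
Proof.
have [n] := ubnP (#|vertices G| + #|hyperedges G| - (#|vertices D| + #|hyperedges D|)).
elim: n D => // n IHn D ltn sD D0 Dc.
have := @classic_EM (exists D', [/\ subhypergraph D' G, connected_no_cut D',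
  subhypergraph D D' & D' <> D]).
apply: classic_bind => -[[D' [sD' Dc' sDD' neq]]|maxD].
  have D0' : hyperedges D' != set0.
    by apply: contraNneq D0 => D'0; case/andP: sDD' => _; rewrite D'0 subset0.
  apply: classic_bind (IHn D' _ sD' D0' Dc') => [[B bB sB] b|].
    by apply; exists B => //; apply: subhypergraph_trans sB.
  have := subhypergraph_size sDD' (nesym neq).
  have : #|vertices D'| <= #|vertices G| by case/andP: sD' => /subset_leq_card.
  have : #|hyperedges D'| <= #|hyperedges G| by case/andP: sD' => _ /subset_leq_card.
  by lia.
move=> b; apply; exists D; last by rewrite /subhypergraph !subxx.
split=> // D' sD' Dc' sDD'.
have [eV|nV] := eqVneq (vertices D') (vertices D); last first.
  by case: maxD; exists D'; split=> // eD; rewrite eD eqxx in nV.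
have [eE|nE] := eqVneq (hyperedges D') (hyperedges D); first exact: hypergraph_eq.
by case: maxD; exists D'; split=> // eD; rewrite eD eqxx in nE.
Qed.

Lemma induced_vertices H : induced H (vertices H) = H.
Proof.
apply: hypergraph_eq => //=; apply/setP=> e; rewrite inE.
by case: (boolP (e \in _)) => //= /hyperedge_sub.
Qed.

Lemma tight_lower r H :
  2 < r -> uniform r H -> tight r H ->
  r.+1 * #|vertices H|.-1 <= r * #|hyperedges H|.
Proof.
move=> r2 Hr [[V0 Hcon] Hblock].
suff grow n U : #|vertices H| - #|U| <= n -> U \subset vertices H -> U != set0 ->
    r.+1 * #|U|.-1 <= r * #|hyperedges (induced H U)| ->
    r.+1 * #|vertices H|.-1 <= r * #|hyperedges H|.
  case/set0Pn: V0 => x xV; apply: (grow _ [set x] (leqnn _)); rewrite ?sub1set //.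
    by apply/set0Pn; exists x; rewrite set11.
  by rewrite cards1 muln0.
elim: n U => [|n IHn] U leU sU U0 boundU.
  have -> : H = induced H U; last by [].
  by rewrite -{1}(induced_vertices H); congr induced; apply/eqP; rewrite eq_sym eqEcard sU; lia.
have [/eqP UV|UV] := boolP (U == vertices H).
  by rewrite UV induced_vertices in boundU.
have /existsP[a /existsP[b /and3P[aU bU]]] :
    [exists a, exists b, [&& a \in U, b \notin U & adj (shadow2 H) a b]].
  apply: contraR UV => no; rewrite eqEsubset sU /=; apply/subsetP=> y yV.
  have /set0Pn[x xU] := U0.
  apply: (connect_invariant (P := [in U]) (Hcon _ _ (subsetP sU x xU) yV) xU) => a b aU ab.
  apply: contraR no => bU; apply/existsP; exists a; apply/existsP; exists b.
  by apply/and3P; split.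
case/adj_shadow2P=> ab [e eE /andP[ae be]].
have sKe : subhypergraph (complete 2 e) (shadow2 H).
  rewrite /subhypergraph /= hyperedge_sub //; apply/subsetP=> p.
  by rewrite inE => /andP[pe /eqP c]; apply/shadow2_edgeP; split=> //; exists e.
have Ke0 : hyperedges (complete 2 e) != set0.
  apply/set0Pn; exists [set a; b]; exact: complete2_adj.
have Kec : connected_no_cut (complete 2 e).
  by apply: complete2_no_cut; apply/set0Pn; exists a.
apply: (block_containing sKe Ke0 Kec) => -[B bB /andP[/subsetP sB _]].
have [cB _ BE] := Hblock B bB.
have [/andP[sBV _] _ _ _] := bB.
set W := vertices B in cB BE sBV.
have aW : a \in W by apply: sB.
have bW : b \in W by apply: sB.
have WE w : w \in W -> W :\ w \in hyperedges H.
  move=> wW; have : W :\ w \in hyperedges (complete r W).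
    by rewrite inE subsetDl; have := cardsD1 w W; rewrite wW cB addn1 add1n => -[<-] /=.
  by rewrite -BE inE => /andP[].
pose N := [set w in W | ~~ (W :\ w \subset U)].
have cUW : #|U :|: W| = #|U| + #|W :\: U|.
  by rewrite cardsU -(cardsID U W) setIC addnA addnAC addnK.
have bD : b \in W :\: U by rewrite inE bU.
have D_gt0 : 0 < #|W :\: U| by apply/card_gt0P; exists b.
apply: (IHn (U :|: W)).
- by rewrite cUW; move: leU D_gt0; move: #|vertices H| #|U| #|W :\: U|; clear; lia.
- by rewrite subUset sU.
- by apply/set0Pn; exists a; rewrite inE aU.
have leN : #|hyperedges (induced H U)| + #|N| <= #|hyperedges (induced H (U :|: W))|.
  rewrite -(card_in_imset (f := fun w => W :\ w) (D := N)).
    rewrite -cardsUI.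
    have -> : hyperedges (induced H U) :&: [set W :\ w | w in N] = set0.
      apply/setP=> f; rewrite !inE; apply/negP=> /andP[/andP[_ fU] /imsetP[w]].
      by rewrite inE => /andP[_ /negP nU] def_f; rewrite -def_f in nU.
    rewrite cards0 addn0; apply/subset_leq_card/subsetP=> f; rewrite !inE.
    case/orP=> [/andP[-> fU]|/imsetP[w]].
      exact: subset_trans fU (subsetUl _ _).
    rewrite inE => /andP[wW _] ->; rewrite WE //=.
    exact: subset_trans (subsetDl _ _) (subsetUr _ _).
  move=> u v; rewrite !inE => /andP[uW _] _ uv; apply: contraTeq uW => neq.
  by have := setD11 u W; rewrite uv !inE neq /= => ->.
have kr : #|W :\: U| <= r.
  suff /proper_card : W :\: U \proper W by rewrite cB addn1 ltnS.
  rewrite properEneq subsetDl andbT.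
  by apply: contraTneq aW => <-; rewrite inE aU.
have Nk : r.+1 * #|W :\: U| <= r * #|N|.
  have [k1|k1] := leqP #|W :\: U| 1.
    have : W :\ b \subset N.
      apply/subsetP=> w; rewrite !inE => /andP[wb wW]; rewrite wW /=.
      by apply: contra bU => /subsetP-> //; rewrite !inE eq_sym wb.
    move/subset_leq_card; have := cardsD1 b W; rewrite bW cB addn1 add1n => -[<-].
    by move: k1 r2; move: #|W :\: U| #|N|; clear; nia.
  have -> : N = W.
    apply/setP=> w; rewrite inE; case: (boolP (w \in W)) => //= wW.
    apply: contraL k1 => /subsetP sU'; rewrite -leqNgt -(cards1 w).
    apply/subset_leq_card/subsetP=> u; rewrite !inE => /andP[uU uW].
    by apply: contraR uU => uw; apply: sU'; rewrite !inE uw.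
  by rewrite cB addn1 mulnC leq_mul2r kr orbT.
have U_gt0 : 0 < #|U| by rewrite card_gt0.
rewrite cUW; move: boundU leN kr Nk U_gt0; clear.
move: #|U| #|W :\: U| #|N| #|_| #|_| => u k n' e1 e2 + + + + u_gt0.
rewrite -(ltn_predK u_gt0) addSn /=; nia.
Qed.
End Converse.

(** * The induction *)

Section Main.
Variables (T : finType) (r : nat).
Hypothesis r3 : 3 <= r.
Implicit Types (H : hypergraph T) (S K : {set T}).

Lemma uniform_induced H S : uniform r H -> uniform r (induced H S).
Proof. by move=> Hr e; rewrite inE => /andP[/Hr]. Qed.

Lemma circumference_below_induced H S k :
  circumference_below H k -> circumference_below (induced H S) k.
Proof.
move=> Hc l v e kl [vI eI ve]; apply: (Hc l v e kl); split=> // i.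
by have [] := ve i; rewrite inE => /andP[].
Qed.

Definition incident H (v : T) (e : {set T}) : bool :=
  (e \in hyperedges H) && (v \in e).

Lemma incidentP H S e :
  reflect (e \in hyperedges H /\ exists2 v, v \in S & v \in e)
          (e \in nbrs (incident H) S).
Proof.
apply: (iffP (nbrsP _ _ _)) => [[v vS /andP[eE ve]]|[eE [v vS ve]]].
  by split=> //; exists v.
by exists v; rewrite // /incident eE.
Qed.

Lemma card_hyperedges_split H K :
  #|hyperedges H| =
  #|hyperedges (induced H (vertices H :\: K))| + #|nbrs (incident H) K|.
Proof.
rewrite -(cardsID (nbrs (incident H) K) (hyperedges H)) addnC; congr (_ + _).
  apply: eq_card => e; rewrite [in LHS]inE [in RHS]inE andbC.
  have [eE|//] := boolP (e \in hyperedges H) => /=.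
  apply/negP/idP=> [eK|/subsetP eK /incidentP[_ [v vK ve]]].
    apply/subsetP=> v ve; rewrite inE (subsetP (hyperedge_sub eE) v ve) andbT.
    by apply/negP=> vK; apply/eK/incidentP; split=> //; exists v.
  by have := eK v ve; rewrite inE vK.
apply: eq_card => e; rewrite inE andbC.
by case: (boolP (e \in nbrs _ _)) => //= /incidentP[].
Qed.

Lemma hyperedges_bound H :
  uniform r H -> circumference_below H (r + 2) -> vertices H != set0 ->
  r * #|hyperedges H| <= r.+1 * #|vertices H|.-1 /\
  (r * #|hyperedges H| = r.+1 * #|vertices H|.-1 -> tight r H).
Proof.
have [n] := ubnP #|vertices H|; elim: n H => // n IHn H ltn Hr Hc V0.
set V := vertices H in ltn V0 *; set E := hyperedges H.
have V_gt0 : 0 < #|V| by rewrite card_gt0.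
have IH S : S \subset V -> S != V -> S != set0 ->
    r * #|hyperedges (induced H S)| <= r.+1 * #|S|.-1 /\
    (r * #|hyperedges (induced H S)| = r.+1 * #|S|.-1 -> tight r (induced H S)).
  move=> sS SV S0; apply: (IHn (induced H S)) => //=.
  - have : #|S| < #|V| by rewrite proper_card // properEneq SV.
    by move: ltn; clear; lia.
  - exact: uniform_induced.
  - exact: circumference_below_induced.
have [V1|V1] := eqVneq #|V| 1.
  have -> : #|E| = 0.
    apply/eqP; rewrite cards_eq0 -subset0; apply/subsetP=> e eE.
    by have := subset_leq_card (hyperedge_sub eE); rewrite (Hr e eE) -/V V1; move: r3; clear; lia.
  by rewrite muln0 V1; split=> // _; apply: tight1 => //; apply: ltnW.
have strict S : S \subset V -> S != set0 -> S != V ->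
    r * #|nbrs (incident H) S| < r.+1 * #|S| -> r * #|E| < r.+1 * #|V|.-1.
  move=> sS S0 SV; have [||//|+ _] := IH (V :\: S); first exact: subsetDl.
  - apply: contraNneq S0 => VS; rewrite -subset0; apply/subsetP=> x xS.
    by have := subsetP sS x xS; rewrite -VS inE xS.
  - by apply: contraNneq SV => VS; rewrite eqEsubset sS -setD_eq0 VS eqxx.
  have := cardsID S V; rewrite (setIidPr sS) {}/E (card_hyperedges_split H S) -/V.
  have : #|V :\: S| > 0.
    by rewrite card_gt0 setD_eq0; apply: contraNN SV => VS; rewrite eqEsubset sS.
  have : #|S| > 0 by rewrite card_gt0.
  move: #|V :\: S| #|S| #|V| #|_| #|_| => a b c d e; clear; nia.
have fin : r * #|E| < r.+1 * #|V|.-1 -> r * #|E| <= r.+1 * #|V|.-1 /\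
  (r * #|E| = r.+1 * #|V|.-1 -> tight r H).
  by move=> lt; split; [exact: ltnW|move=> eq; rewrite eq ltnn in lt].
have [/forall_inP hallV|/forall_inPn[S]] :=
    boolP [forall S : {set T} in powerset V, #|S| <= #|nbrs (incident H) S|]; last first.
  rewrite powersetE -ltnNge => sS ltS; apply: fin.
  have S_gt0 : 0 < #|S| by apply: leq_ltn_trans ltS.
  have [SV|SV] := eqVneq S V; last first.
    apply: (strict S) => //; first by rewrite -card_gt0.
    by move: ltS; clear; nia.
  have : #|E| <= #|nbrs (incident H) S|.
    apply/subset_leq_card/subsetP=> e eE; apply/incidentP; split=> //.
    have /card_gt0P[v ve] : 0 < #|e| by rewrite (Hr e eE) (leq_trans _ r3).
    by exists v => //; rewrite SV (subsetP (hyperedge_sub eE)).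
  by move: ltS V1 V_gt0; rewrite SV; clear -r3; nia.
have [S sS|f [fR fI]] := @hall T {set T} set0 (incident H) V.
  by apply: hallV; rewrite powersetE.
have sf : selects H f by split=> // v vV; apply/andP/fR.
have /card_gt0P[v0 v0V] := V_gt0.
have [|W [sWV cW dense]] := @selects_dense T H r (ltnW r3) Hr Hc f [:: v0] sf.
  by rewrite /directed_path /= v0V.
have W0 : W != set0 by rewrite -card_gt0 cW.
have [VW|] := eqVneq (V :\: W) set0.
  have {}VW : V = W by apply/eqP; rewrite eqEsubset sWV -setD_eq0 VW eqxx.
  have sE : E \subset hyperedges (complete r V).
    apply/subsetP=> e eE; rewrite inE hyperedge_sub //=; exact/eqP/Hr.
  have cC : #|hyperedges (complete r V)| = r.+1.
    by rewrite VW cards_draws cW -bin_sub ?leqnSn // subSnn bin1.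
  have leE : #|E| <= r.+1 by rewrite -cC subset_leq_card.
  rewrite VW cW /=; split; first by rewrite mulnC leq_mul2r leE orbT.
  move=> eqE; apply: tight_complete => //; first by rewrite -/V VW.
  apply: hypergraph_eq => //; apply/eqP; rewrite eqEcard sE cC.
  by rewrite -(leq_pmul2l (ltnW (ltnW r3))) [r * #|_|]eqE mulnC /=.
case/set0Pn=> z zVW.
pose conn := connect (incidence_off H W).
pose K := [set v in V :\: W | conn (inl z) (inl v)].
have zK : z \in K by rewrite inE zVW; apply: connect0.
have sKV : K \subset V by apply/subsetP=> v; rewrite !inE => /andP[/andP[]].
have KW v : v \in K -> v \notin W by rewrite !inE => /andP[/andP[]].
have K0 : K != set0 by apply/set0Pn; exists z.
have [w wW] := set0Pn _ W0.
have wV : w \in V := subsetP sWV w wW.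
have wK : w \notin K by apply: contraL wW => /KW.
have KV : K != V by apply: contraNneq wK => ->.
have toE e v : e \in E -> v \in e -> v \in K -> conn (inl z) (inr e).
  move=> eE ve vK; have := vK; rewrite inE => /andP[_ zv].
  by apply: connect_trans zv (connect1 _); rewrite /= eE ve KW.
have inK e v u : e \in E -> v \in e -> v \in K -> u \in e -> u \notin W -> u \in K.
  move=> eE ve vK ue uW; rewrite !inE uW (subsetP (hyperedge_sub eE) u ue) /=.
  by apply: connect_trans (toE e v eE ve vK) (connect1 _); rewrite /= eE ue.
pose X := [set e in nbrs (incident H) K | e :&: W != set0].
have [leX|] := leqP #|X| 1.
  apply: fin; apply: (strict K) => //.
  have [+ _] := IH K sKV KV K0.
  have : #|nbrs (incident H) K| <= #|hyperedges (induced H K)| + #|X|.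
    rewrite addnC -(cardsID X (nbrs _ _)); apply: leq_add.
      exact/subset_leq_card/subsetIr.
    apply/subset_leq_card/subsetP=> e; rewrite inE => /andP[eX eN].
    have [eE [v vK ve]] := incidentP _ _ _ eN.
    rewrite inE eE; apply/subsetP=> u ue; apply: (inK _ _ _ eE ve vK ue).
    apply: contra eX => uW; rewrite inE eN; apply/set0Pn; exists u.
    by rewrite inE ue.
  have : 0 < #|K| by rewrite card_gt0.
  by move: leX; clear -r3; nia.
case/card_gt1P=> f1 [g1 [fX gX fg]].
have XP e : e \in X -> [/\ e \in E, conn (inl z) (inr e) & exists x, x \in e :&: W].
  rewrite inE => /andP[/incidentP[eE [v vK ve]] /set0Pn eW].
  by split=> //; apply: toE ve vK.
have uniqX e1 e2 x y : e1 \in X -> e2 \in X -> e1 != e2 ->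
    x \in e1 :&: W -> y \in e2 :&: W -> x = y.
  move=> /XP[E1 z1 _] /XP[E2 z2 _]; apply: (attachment_unique r3 Hr cW dense Hc E1 E2).
  apply: connect_trans z2.
  by rewrite (sym_connect_sym (@incidence_off_sym _ H W)).
have [_ _ [x xf]] := XP _ fX.
have [_ _ [x' xg]] := XP _ gX.
have xX e y : e \in X -> y \in e :&: W -> y = x.
  move=> eX ye; have [ef|ef] := eqVneq e f1; last exact: uniqX ef ye xf.
  rewrite ef in eX ye; rewrite (uniqX _ _ _ _ fX gX fg ye xg).
  by rewrite (uniqX _ _ _ _ fX gX fg xf xg).
have xW : x \in W by case/setIP: xf.
have xV : x \in V := subsetP sWV x xW.
have xK : x \notin K by apply: contraL xW => /KW.
have nbrK e : e \in nbrs (incident H) K -> e \subset x |: K.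
  move=> eN; have [eE [v vK ve]] := incidentP _ _ _ eN.
  apply/subsetP=> u ue; rewrite !in_setU1; have [uW|uW] := boolP (u \in W); last first.
    by rewrite (inK e v u) ?orbT.
  have uW' : u \in e :&: W by rewrite inE ue.
  rewrite (xX e u) ?eqxx // inE eN; apply/set0Pn; by exists u.
have split_e e : e \in E -> (e \subset x |: K) || (e \subset V :\: K).
  move=> eE; have [/nbrK->//|eN] := boolP (e \in nbrs (incident H) K).
  apply/orP; right; apply/subsetP=> v ve; rewrite inE (subsetP (hyperedge_sub eE)) // andbT.
  by apply: contra eN => vK; apply/incidentP; split=> //; exists v.
have cK : #|hyperedges (induced H (x |: K))| = #|nbrs (incident H) K|.
  apply: eq_card => e; rewrite inE; apply/andP/idP=> [[eE se]|eN]; last first.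
    by split; [case/incidentP: eN|apply: nbrK].
  apply/incidentP; split=> //.
  have : ~~ (e \subset [set x]).
    apply/negP=> /subset_leq_card; rewrite (Hr e eE) cards1.
    by move: r3; clear; lia.
  case/subsetPn=> v ve; rewrite inE => vx; exists v => //.
  by have := subsetP se v ve; rewrite in_setU1 (negPf vx).
have cxK : #|x |: K| = #|K|.+1 by rewrite cardsU1 xK.
have [|||] := IH (x |: K); first by rewrite subUset sub1set xV.
- apply/eqP=> xKV; have : W \subset [set x].
    apply/subsetP=> v vW; have : v \in x |: K by rewrite xKV (subsetP sWV).
    by rewrite in_setU1 inE => /orP[//|/KW]; rewrite vW.
  by move/subset_leq_card; rewrite cW cards1; move: r3; clear; lia.
- by apply/set0Pn; exists x; rewrite setU11.
rewrite cK cxK => b1 t1.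
have [|||] := IH (V :\: K); first exact: subsetDl.
- apply/eqP=> VK; have : z \in V :\: K by rewrite VK (subsetP sKV).
  by rewrite inE zK.
- by apply/set0Pn; exists w; rewrite inE wK.
move=> b2 t2.
have cV := cardsID K V; rewrite (setIidPr sKV) in cV.
have cVK : 0 < #|V :\: K| by apply/card_gt0P; exists w; rewrite inE wK.
rewrite {1 2}/E (card_hyperedges_split H K) -/V.
move: b1 b2 t1 t2 cV cVK => /= b1 b2 t1 t2 cV cVK.
split; first by move: b1 b2 cV cVK; clear; nia.
move=> eqE; apply: (tight_glue (K := K) (x := x)) => //.
  by apply: t1; move: eqE b1 b2 cV cVK; clear; nia.
by apply: t2; move: eqE b1 b2 cV cVK; clear; nia.
Qed.

End Main.

Import Order.TTheory GRing.Theory Num.Theory.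
Local Open Scope ring_scope.

Theorem theorem4 (r n : nat) (hr : (3 <= r)%N) (hn : (1 <= n)%N)
    (T : finType) (H : hypergraph T) (hHn : #|vertices H| = n)
    (hHr : uniform r H)
    (hH : forall (l : nat) (v : 'I_l -> T) (e : 'I_l -> {set T}),
        (r + 2 <= l)%N -> ~ berge_cycle H v e) :
  (#|hyperedges H|%:R <= (r%:R + 1) / r%:R * (n%:R - 1) :> rat) /\
  (#|hyperedges H|%:R = (r%:R + 1) / r%:R * (n%:R - 1) :> rat <->
   connected_graph (shadow2 H) /\
   forall D : hypergraph T, block (shadow2 H) D ->
     [/\ #|vertices D| = (r + 1)%N,
         D = complete 2 (vertices D) &
         induced H (vertices D) = complete r (vertices D)]).
Proof.
have V0 : vertices H != set0 by rewrite -card_gt0 hHn.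
have r_gt0 : 0 < r%:R :> rat by rewrite ltr0n (ltn_trans _ hr).
have rhsE : (r%:R + 1) / r%:R * (n%:R - 1) = (r.+1 * n.-1)%:R / r%:R :> rat.
  by rewrite natr1 natrM -subn1 natrB // mulrAC.
have [] := hyperedges_bound hr hHr hH V0; rewrite hHn => le_e tight_e.
rewrite rhsE; split; first by rewrite ler_pdivlMr // -natrM ler_nat mulnC.
have eqE : (#|hyperedges H|%:R == (r.+1 * n.-1)%:R / r%:R :> rat) =
    (r * #|hyperedges H| == r.+1 * n.-1)%N.
  by rewrite -(inj_eq (mulIf (lt0r_neq0 r_gt0))) divfK ?lt0r_neq0 // -natrM eqr_nat mulnC.
split=> [/eqP|Ht]; first by rewrite eqE => /eqP/tight_e.
apply/eqP; rewrite eqE eqn_leq le_e /=.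
by have := tight_lower hr hHr Ht; rewrite hHn.
Qed.
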